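(* Let $G$ be an amenable group (not necessarily finitely generated) with finitely additive left-invariant mean $\mu$. Then the following hold. (1) If $\textup{dc}_\mu(G)>\frac{5}{8}$ then $G$ is abelian. (2) If $\textup{dc}_\mu(G)\ge\frac{1}{2}+\varepsilon$ for some $\varepsilon>0$ then the centre of $G$ has index at most $\frac{1}{\varepsilon}$ in $G$. (3) There is an absolute constant $C>0$ such that if $\textup{dc}_\mu(G)\ge\alpha>0$ then $G$ has a normal subgroup $\Gamma$ of index at most $\lceil\alpha^{-1}\rceil$ and a normal subgroup $H$ of cardinality at most $\exp(C\alpha^{-C})$ such that $H\subset\Gamma$ and $\Gamma/H$ is abelian.
   Context: A finitely additive mean on $G$ is a positive linear functional $f\mapsto\int f\,d\mu$ on $\ell^\infty(G)$ with $\int1_G\,d\mu=1$; it is left-invariant if $\int g\cdot f\,d\mu=\int f\,d\mu$ for all $f\in\ell^\infty(G)$, $g\in G$, where $g\cdot f(x)=f(g^{-1}x)$. Write $\mu(X)=\int1_X\,d\mu$. The product mean is $\int_{G\times G}f\,d(\mu\times\mu)=\int_{x\in G}\int_{y\in G}f(x,y)\,d\mu(x)\,d\mu(y)$, and $\textup{dc}_\mu(G)=(\mu\times\mu)(\{(x,y)\in G\times G:xy=yx\})$. *)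

(* Defs.v *)
From HB Require Import structures.
From mathcomp Require Import all_boot all_order all_algebra.
From mathcomp Require Import monoid.
From mathcomp Require Import all_classical all_reals all_analysis.
Set Implicit Arguments. Unset Strict Implicit. Unset Printing Implicit Defensive.
Import Order.TTheory GRing.Theory Num.Theory.
Local Open Scope ring_scope.

Section Means.
Variables (R : realType) (G : groupType).

Definition bounded_fun (T : Type) (f : T -> R) : Prop :=
  exists M : R, forall x, `|f x| <= M.

Definition ind (P : Prop) : R := if pselect P then 1 else 0.

(* A finitely additive mean on G: a positive linear functional on l^oo(G)
   with value 1 on the constant function 1.  Values on unbounded functions
   are irrelevant (unconstrained). *)
Definition is_mean (m : (G -> R) -> R) : Prop :=
  [/\ (forall f g, bounded_fun f -> bounded_fun g ->
          m (fun x => f x + g x) = m f + m g),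
      (forall (c : R) f, bounded_fun f -> m (fun x => c * f x) = c * m f),
      (forall f, bounded_fun f -> (forall x, 0 <= f x) -> 0 <= m f)
    & m (fun _ => 1) = 1].

Definition left_invariant (m : (G -> R) -> R) : Prop :=
  forall (f : G -> R) (g : G), bounded_fun f ->
    m (fun x => f (g^-1 * x)%g) = m f.

Definition prod_mean (m : (G -> R) -> R) (f : G * G -> R) : R :=
  m (fun x => m (fun y => f (x, y))).

Definition dc (m : (G -> R) -> R) : R :=
  prod_mean m (fun p => ind (p.1 * p.2 = p.2 * p.1)%g).

Definition abelian_grp : Prop := forall x y : G, (x * y = y * x)%g.

Definition centre : G -> Prop := fun z => forall y : G, (z * y = y * z)%g.

Definition is_subgroup (H : G -> Prop) : Prop :=
  [/\ H 1%g, (forall x y, H x -> H y -> H (x * y)%g) & (forall x, H x -> H x^-1%g)].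

Definition is_normal (H : G -> Prop) : Prop :=
  is_subgroup H /\ forall g x, H x -> H (g^-1 * x * g)%g.

(* H is a subgroup of the subgroup K with K/H abelian (H normal in K):
   all commutators of elements of K lie in H *)
Definition quotient_abelian (K H : G -> Prop) : Prop :=
  forall x y, K x -> K y -> H (x^-1 * y^-1 * x * y)%g.

Definition index_atmost (H : G -> Prop) (n : nat) : Prop :=
  exists k (t : 'I_k -> G), (k <= n)%N /\ forall g : G, exists i, H ((t i)^-1 * g)%g.

Definition card_atmost (H : G -> Prop) (r : R) : Prop :=
  exists k (t : 'I_k -> G), k%:R <= r /\ forall h, H h -> exists i, t i = h.

End Means.

(* Main.v *)
(* A subgroup of positive measure [mu] has index [mu^-1], so
   [dc = m (x |-> mu (C x))].  If [x] is not central then [mu (C x) <= 1 / 2],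
   whence [dc <= 1 / 2 + mu Z / 2], which gives (1) and (2).

   For (3) let [N = ceil alpha^-1], [r = N (N + 1) + 1], let [X] be the set of
   [x] with [mu (C x) >= r^-1] and [K] the subgroup generated by [X].  Then
   [mu X > (N + 1)^-1], so [K] has index at most [N] and every element of [K]
   is a product of [3 N] elements of [X]; hence the centralisers of elements of
   [K] have measure bounded below by [2^-W] with [W] polynomial in [N].

   For [x] in [X] the quotients of [K]-conjugates of [x] generate a normal
   subgroup of [K] of order at most [(r!)^r], because [x^(r!)] is central in
   [K]; killing it makes [x] central.  As long as the quotient is not abelian,
   kill in this way some non-central [x] in [X].  At least half of [K] does not
   commute with [x], and for each such [g] the measure of the centraliser of [g]
   at least doubles.  So each [g] is affected at most [W] times and the process
   stops after at most [2 W] steps, leaving the derived subgroup of [K] inside a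
   set of size [((r!)^r)^(2 W)]. *)

Require Import Defs.
From HB Require Import structures.
From mathcomp Require Import all_boot all_order all_algebra.
From mathcomp Require Import monoid.
From mathcomp Require Import all_classical all_reals all_analysis.
From mathcomp Require Import zify ring lra.
Import Order.TTheory GRing.Theory Num.Theory.
Local Open Scope ring_scope.
Set Implicit Arguments.
Unset Strict Implicit.

Ltac gsimp := rewrite ?(conjgE, mulgA, invgM, invgK, mulgK, mulgVK, mulVg, mulgV,
  mul1g, mulg1, invg1).

(** * Generated subgroups and the collection of words *)

Section GeneratedSubgroups.
Local Open Scope group_scope.
Variable G : groupType.
Implicit Types (D H K : G -> Prop) (g x y : G) (w S : seq G).

(** Words contain no inverses, so this is a submonoid in general. It is a subgroup once [D] is
    closed under inversion, as every generating set below is. *)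
Definition gen D : G -> Prop :=
  fun g => exists w, (forall x, x \in w -> D x) /\ g = \prod_(x <- w) x.

Lemma gen_incl D x : D x -> gen D x.
Proof.
move=> Dx; exists [:: x]; rewrite big_seq1; split => // y.
by rewrite inE => /eqP ->.
Qed.

Lemma gen_min D H : H 1 -> (forall x y, H x -> H y -> H (x * y)) ->
  (forall x, D x -> H x) -> forall g, gen D g -> H g.
Proof.
move=> H1 HM DH g [w [wD ->]].
elim: w wD => [|x w IH] wD; first by rewrite big_nil.
rewrite big_cons; apply: HM; first by apply/DH/wD; rewrite mem_head.
by apply: IH => y yw; apply: wD; rewrite inE yw orbT.
Qed.

Lemma gen1 D : gen D 1.
Proof. by exists [::]; rewrite big_nil. Qed.

Lemma genM D x y : gen D x -> gen D y -> gen D (x * y).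
Proof.
move=> [v [vD ->]] [w [wD ->]]; exists (v ++ w); rewrite big_cat; split=> // z.
by rewrite mem_cat => /orP[/vD|/wD].
Qed.

Lemma genV D : (forall x, D x -> D x^-1) -> forall x, gen D x -> gen D x^-1.
Proof.
move=> DV; apply: gen_min => [|x y gx gy|x /DV Dx]; rewrite ?invg1 ?invgM.
- exact: gen1.
- exact: genM.
- exact: gen_incl.
Qed.

Lemma gen_subgroup D : (forall x, D x -> D x^-1) -> is_subgroup (gen D).
Proof. by move=> DV; split; [exact: gen1|exact: genM|exact: genV]. Qed.

Lemma genJ D g : (forall x, D x -> D (x ^ g)) ->
  forall x, gen D x -> gen D (x ^ g).
Proof.
move=> DJ; apply: gen_min => [|x y gx gy|x /DJ Dx]; rewrite ?conj1g ?conjMg.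
- exact: gen1.
- exact: genM.
- exact: gen_incl.
Qed.

Lemma subgroupX H x n : is_subgroup H -> H x -> H (x ^+ n).
Proof.
case=> H1 HM _ Hx; elim: n => [|n IH]; first by rewrite expg0.
by rewrite expgS; apply: HM.
Qed.

Lemma subgroupJ H x g : is_subgroup H -> H x -> H g -> H (x ^ g).
Proof. by case=> H1 HM HV Hx Hg; rewrite conjgE; apply/HM/HM => //; apply: HV. Qed.

(* The value of a word over [nat] read as a numeral in base [q]; swapping an
   inverted pair of letters decreases it whatever the new second letter. *)
Definition word_rank q (w : seq nat) := foldl (fun a i => (a * q + i)%N) 0%N w.

Lemma word_rank_cat q u v :
  word_rank q (u ++ v) = (word_rank q u * q ^ size v + word_rank q v)%N.
Proof.
rewrite /word_rank foldl_cat; move: (foldl _ _ u) => a.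
elim/last_ind: v a => [|v i IH] a /=; first by rewrite expn0 muln1 addn0.
by rewrite !foldl_rcons IH size_rcons expnS; nia.
Qed.

Lemma not_sorted_inversion (w : seq nat) : ~~ sorted leq w ->
  exists u i j v, w = u ++ [:: i, j & v] /\ (j < i)%N.
Proof.
elim: w => [//|i [//|j w] IH] /=.
rewrite negb_and -ltnNge => /orP[ji|/IH[u [a [b [v [-> ba]]]]]].
  by exists [::], i, j, w.
by exists (i :: u), a, b, v.
Qed.

Lemma sorted_filter_leq k (w : seq nat) : sorted leq w ->
  [seq i <- w | (k <= i)%N] = nseq (count_mem k w) k ++ [seq i <- w | (k < i)%N].
Proof.
elim: w => [//|a w IH] /= aw; rewrite IH ?(path_sorted aw) //.
case: (ltngtP k a) => [ka|//|<-] //=.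
have -> : count_mem k w = 0%N; last by [].
apply/count_memPn/negP => kw.
by move: aw; rewrite (path_sortedE leq_trans) => /andP[/allP/(_ _ kw)]; lia.
Qed.

Lemma prod_sorted_word (F : nat -> G) q (w : seq nat) :
  sorted leq w -> all (fun i => (i < q)%N) w ->
  \prod_(i <- w) F i = \prod_(0 <= i < q) F i ^+ count_mem i w.
Proof.
move=> sw wq.
(* Induction on [k] splits off the letters below [k], an initial block of the sorted word. *)
suff H k : \prod_(i <- w) F i = \prod_(0 <= i < k) F i ^+ count_mem i w *
    \prod_(i <- [seq i <- w | (k <= i)%N]) F i.
  rewrite (H q) (_ : [seq i <- w | _] = [::]) ?big_nil ?mulg1 //.
  apply/eqP; rewrite -size_eq0 size_filter -leqn0 leqNgt -has_count.
  by apply/hasPn => i /(allP wq); rewrite -ltnNge.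
elim: k => [|k ->]; first by rewrite big_nil mul1g filter_predT.
rewrite sorted_filter_leq // big_cat big_nat_recr //= -mulgA; congr (_ * (_ * _)).
by rewrite big_nseq iter_mulg_1.
Qed.

(** Since [x * y = y * x ^ y] and [S] is closed under conjugation, an inverted pair [i, j] can be
    rewritten as [j, k] without changing product or length. This terminates because
    [j * q + k < i * q + j] when [j < i] and [k < q]. *)
Lemma sort_word S (w : seq nat) :
  (forall x y, x \in S -> y \in S -> x ^ y \in S) ->
  all (fun i => (i < size S)%N) w ->
  exists w' : seq nat, [/\ sorted leq w', all (fun i => (i < size S)%N) w',
    size w' = size w & \prod_(i <- w') S`_i = \prod_(i <- w) S`_i].
Proof.
move=> SJ; have [n le_n] := ubnP (word_rank (size S) w).
elim: n => // n IH in w le_n *; move=> wS.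
have [sw|/not_sorted_inversion] := boolP (sorted leq w); first by exists w.
move=> [u [i [j [v [w_eq ji]]]]]; subst w.
move: wS; rewrite all_cat /= => /and4P[uS iS jS vS].
set k := index (S`_i ^ S`_j) S.
have kin : S`_i ^ S`_j \in S by apply: SJ; exact: mem_nth.
have kS : (k < size S)%N by rewrite index_mem.
have [||w' [sw' w'S sz' pr']] := IH (u ++ [:: j, k & v]).
- rewrite -ltnS; apply: leq_trans le_n; rewrite ltnS.
  rewrite -![_ ++ [:: _, _ & _]]/(_ ++ ([:: _; _] ++ _)) !word_rank_cat /=.
  rewrite ltn_add2l ltn_add2r /word_rank /= ltn_mul2r expn_gt0.
  by nia.
- by rewrite all_cat /= uS jS kS vS.
exists w'; split=> //; first by rewrite sz' !size_cat.
rewrite pr' !big_cat !big_cons /k nth_index //; congr (_ * _).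
by rewrite /=; gsimp.
Qed.

(** The exponents are the multiplicities in the sorted word. Their sum is recorded because the
    length of [w] later determines a power of a central element. *)
Lemma collect_word S w :
  (forall x y, x \in S -> y \in S -> x ^ y \in S) -> (forall x, x \in w -> x \in S) ->
  exists f : nat -> nat, (\sum_(0 <= i < size S) f i)%N = size w /\
    \prod_(x <- w) x = \prod_(0 <= i < size S) S`_i ^+ f i.
Proof.
move=> SJ wS.
have [|w' [sw' w'S sz' pr']] := @sort_word S [seq index x S | x <- w] SJ.
  by apply/allP => _ /mapP[x /wS xS ->]; rewrite index_mem.
exists (fun i => count_mem i w'); split.
  rewrite size_map in sz'; rewrite -sz' -[RHS]sum1_size.
  have -> : (\sum_(j <- w') 1 = \sum_(j <- w') \sum_(0 <= i < size S) (i == j))%N.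
    rewrite big_seq_cond [RHS]big_seq_cond; apply: eq_bigr => j /andP[/(allP w'S) jS _].
    rewrite (bigD1_seq j) ?mem_index_iota ?iota_uniq //= eqxx big1 // => i.
    by move/negPf => ->.
  rewrite exchange_big; apply: eq_bigr => i _.
  rewrite -sum1_count big_mkcond; apply: eq_bigr => j _ /=.
  by rewrite eq_sym; case: eqP.
rewrite -(prod_sorted_word (fun i => S`_i) sw' w'S) pr' big_map.
rewrite big_seq [RHS]big_seq; apply: eq_bigr => x /wS xS.
by rewrite nth_index.
Qed.

Definition covered H (k : nat) : Prop :=
  exists l : seq G, (size l <= k)%N /\ forall g, H g -> g \in l.

Definition class_of K x : G -> Prop := fun y => exists2 g, K g & y = x ^ g.

(** For [x] in a subgroup [K] this is [[K, x]], the smallest normal subgroup of [K] modulo which [x]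
    is central. *)
Definition class_quotients K x : G -> Prop :=
  gen (fun d => exists y z, [/\ class_of K x y, class_of K x z & d = y / z]).

(* Every element is a word of length [n * b] over the class of [x], divided by
   [x ^+ (n * b)]; collecting the word and reducing its exponents modulo [n]
   makes the power of [x ^+ n] a function of the reduced exponents. *)
Lemma class_quotients_covered K x S n : is_subgroup K -> K x ->
  (forall y, (y \in S) <-> class_of K x y) -> (0 < n)%N ->
  (forall g, K g -> commute (x ^+ n) g) ->
  covered (class_quotients K x) (n ^ size S).
Proof.
move=> KG Kx SE n_gt0 xnC; have [K1 KM KV] := KG.
set z := x ^+ n.
have SK y : y \in S -> K y by move/SE => [g Kg ->]; exact: subgroupJ.
have SX y : y \in S -> y ^+ n = z.
  move/SE => [g Kg ->]; rewrite -conjXg.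
  by apply/conjg_fixP/commgP/xnC.
have SJ y y' : y \in S -> y' \in S -> y ^ y' \in S.
  move=> /SE[g Kg ->] /SK Ky'; apply/SE; exists (g * y'); first exact: KM.
  by rewrite conjgM.
have zC i g : K g -> commute (z ^+ i) g.
  by move=> Kg; apply/commute_sym/commuteX/commute_sym/xnC.
have prodK (r : seq nat) (f : nat -> nat) :
    all (fun i => (i < size S)%N) r -> K (\prod_(i <- r) S`_i ^+ f i).
  elim: r => [|i r IH] /=; first by rewrite big_nil.
  move=> /andP[iS rS]; rewrite big_cons; apply: KM; last exact: IH.
  by apply: subgroupX => //; apply/SK/mem_nth.
pose quotient_word g := exists w b,
    [/\ forall y, y \in w -> y \in S, size w = (n * b)%N
      & g = \prod_(y <- w) y / z ^+ b].
have words : forall g, class_quotients K x g -> quotient_word g.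
  apply: gen_min => [|g h [v [b [vS sv ->]]] [w [c [wS sw ->]]]|
      _ [y [y' [/SE yS /SE y'S ->]]]].
  - by exists [::], 0%N; rewrite big_nil muln0 expg0 divg1.
  - exists (v ++ w), (b + c)%N; split.
    + by move=> y; rewrite mem_cat => /orP[/vS|/wS].
    + by rewrite size_cat sv sw mulnDr.
    + have Kw : K (\prod_(y <- w) y).
        rewrite big_seq; elim/big_rec: _ => [//|y u yw Ku].
        by apply: KM => //; apply/SK/wS.
      have zcomm : commute (z ^- b) (\prod_(y <- w) y / z ^+ c).
        apply/commute_sym/commuteV/commute_sym/commuteM; first exact: zC.
        by apply/commuteV/commuteX2/commute_refl.
      rewrite big_cat /= expgnDr invgM -!mulgA; congr (_ * _).
      by rewrite [RHS]mulgA; exact: zcomm.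
  (* As [y' ^+ n = z], the inverse of [y'] is [y' ^+ n.-1 / z], which costs one factor [z] and makes
     a word of length [n]. *)
  - exists (y :: nseq n.-1 y'), 1%N; split.
    + by move=> u; rewrite inE mem_nseq => /orP[/eqP ->|/andP[_ /eqP ->]].
    + by rewrite /= size_nseq prednK // muln1.
    + have y'n : y' ^+ n = y' * y' ^+ n.-1 by rewrite -expgS prednK.
      by rewrite big_cons big_nseq iter_mulg_1 expg1 -(SX _ y'S) y'n /=; gsimp.
(* Reducing exponents modulo [n] releases a power [z ^+ c]. The total length is [n * b], so the
   residues sum to [n * (b - c)] and alone determine the remaining factor [z ^- (b - c)]. *)
pose t (a : {ffun 'I_(size S) -> 'I_n}) :=
  (\prod_(i < size S) S`_i ^+ a i) / z ^+ ((\sum_i a i) %/ n).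
exists [seq t a | a <- enum {ffun 'I_(size S) -> 'I_n}]; split.
  by rewrite size_map -cardE card_ffun !card_ord.
move=> g /words[w [b [wS sw ->]]].
have [f [sf ->]] := collect_word SJ wS.
apply/mapP; exists [ffun i : 'I_(size S) => Ordinal (ltn_pmod (f i) n_gt0)].
  by rewrite mem_enum.
have -> : t [ffun i : 'I_(size S) => Ordinal (ltn_pmod (f i) n_gt0)] =
    (\prod_(i < size S) S`_i ^+ (f i %% n)) / z ^+ ((\sum_(i < size S) f i %% n) %/ n).
  by rewrite /t; congr (_ / _ ^+ (_ %/ _)); apply: eq_bigr => i _; rewrite ffunE.
have split_prod (r : seq nat) : all (fun i => (i < size S)%N) r ->
    \prod_(i <- r) S`_i ^+ f i =
    \prod_(i <- r) S`_i ^+ (f i %% n) * z ^+ (\sum_(i <- r) f i %/ n).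
  elim: r => [_|i r IH /= /andP[iS rS]]; first by rewrite !big_nil mul1g expg0.
  rewrite !big_cons IH // {1}(divn_eq (f i) n) addnC expgnDr mulnC expgnA.
  rewrite (SX (S`_i)) ?mem_nth // expgnDr -!mulgA; congr (_ * _).
  by rewrite !mulgA; congr (_ * _); apply: zC; exact: prodK.
rewrite split_prod; last by apply/allP => i; rewrite mem_index_iota.
rewrite -!(big_mkord xpredT (fun i => S`_i ^+ (f i %% n))) -!(big_mkord xpredT (fun i => f i %% n)%N).
set c := (\sum_(_ <= i < _) f i %/ n)%N; set a := (\sum_(_ <= i < _) f i %% n)%N.
have eqb : (a + n * c = n * b)%N.
  rewrite -sw -sf /a /c big_distrr -big_split /=; apply: eq_bigr => i _.
  by rewrite {3}(divn_eq (f i) n) addnC mulnC.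
have cb : (c <= b)%N by rewrite -(leq_pmul2l n_gt0) -eqb leq_addl.
have -> : (a %/ n = b - c)%N.
  by rewrite (_ : a = n * (b - c))%N ?mulKn // mulnBr -eqb addnK.
by rewrite -{1}(subnK cb) expgnDr; gsimp.
Qed.

End GeneratedSubgroups.

(** * Measures of sets, translates and cosets *)

Section Means.
Variables (R : realType) (G : groupType) (m : (G -> R) -> R).
Hypotheses (m_mean : is_mean m) (m_inv : left_invariant m).
Implicit Types (A B P : G -> Prop) (f : G -> R) (s : seq G).

Let bounded (f : G -> R) := Defs.bounded_fun f.

Definition mu A : R := m (fun x => ind R (A x)).

Lemma indT (Q : Prop) : Q -> ind R Q = 1.
Proof. by rewrite /ind; case: pselect. Qed.

Lemma indF (Q : Prop) : ~ Q -> ind R Q = 0.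
Proof. by rewrite /ind; case: pselect. Qed.

Lemma ind_ge0 (Q : Prop) : 0 <= ind R Q.
Proof. by rewrite /ind; case: pselect. Qed.

Lemma ind_le1 (Q : Prop) : ind R Q <= 1.
Proof. by rewrite /ind; case: pselect. Qed.

Lemma bounded_range f M : (forall x, 0 <= f x <= M) -> bounded f.
Proof. by move=> fM; exists M => x; have /andP[f0 fM'] := fM x; rewrite ger0_norm. Qed.

Lemma bounded_ind A : bounded (fun x => ind R (A x)).
Proof. by apply: (@bounded_range _ 1) => x; rewrite ind_ge0 ind_le1. Qed.

Lemma bounded_cst c : bounded (fun _ => c).
Proof. by exists `|c|. Qed.

Lemma boundedD f g : bounded f -> bounded g -> bounded (fun x => f x + g x).
Proof.
move=> [M fM] [M' gM]; exists (M + M') => x.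
by apply: le_trans (ler_normD _ _) _; apply: lerD.
Qed.

Lemma boundedZ c f : bounded f -> bounded (fun x => c * f x).
Proof. by move=> [M fM]; exists (`|c| * M) => x; rewrite normrM ler_wpM2l. Qed.

Lemma meanD f g : bounded f -> bounded g -> m (fun x => f x + g x) = m f + m g.
Proof. by case: m_mean => + _ _ _; apply. Qed.

Lemma meanZ c f : bounded f -> m (fun x => c * f x) = c * m f.
Proof. by case: m_mean => _ + _ _; apply. Qed.

Lemma mean_cst c : m (fun _ => c) = c.
Proof.
case: m_mean => _ mZ _ m1.
have -> : (fun _ : G => c) = (fun _ => c * 1) by apply/funext => x; rewrite mulr1.
by rewrite mZ ?m1 ?mulr1 //; exact: bounded_cst.
Qed.

Lemma mean_le f g : bounded f -> bounded g -> (forall x, f x <= g x) -> m f <= m g.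
Proof.
move=> bf bg fg; have bN := boundedZ (-1) bf.
case: m_mean => _ _ m_pos _.
have := m_pos _ (boundedD bg bN).
rewrite meanD // meanZ // mulN1r subr_ge0; apply=> x.
by rewrite mulN1r subr_ge0.
Qed.

Lemma bounded_sum (T : eqType) (t : seq T) (F : T -> G -> R) :
  (forall i, bounded (F i)) -> bounded (fun x => \sum_(i <- t) F i x).
Proof.
move=> bF; elim: t => [|i t [M IH]].
  by exists 0 => x; rewrite big_nil normr0.
have [M' FM] := bF i; exists (M' + M) => x; rewrite big_cons.
by apply: le_trans (ler_normD _ _) _; apply: lerD.
Qed.

Lemma mean_sum (T : eqType) (t : seq T) (F : T -> G -> R) :
  (forall i, bounded (F i)) ->
  m (fun x => \sum_(i <- t) F i x) = \sum_(i <- t) m (F i).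
Proof.
move=> bF; elim: t => [|i t IH].
  rewrite big_nil -[RHS](mean_cst 0); congr m.
  by apply/funext => x; rewrite big_nil.
rewrite big_cons -IH -meanD //; last exact: bounded_sum.
by congr m; apply/funext => x; rewrite big_cons.
Qed.

Lemma mu_ge0 A : 0 <= mu A.
Proof.
by case: m_mean => _ _ + _; apply; [exact: bounded_ind|move=> x; exact: ind_ge0].
Qed.

Lemma mu_le A B : (forall x, A x -> B x) -> mu A <= mu B.
Proof.
move=> AB; apply: mean_le => [||x]; [exact: bounded_ind..|].
by have [/[dup] /AB Bx Ax|Ax] := pselect (A x);
  rewrite ?(indT Ax) ?(indT Bx) ?(indF Ax) ?ind_ge0.
Qed.

Lemma mu_full A : (forall x, A x) -> mu A = 1.
Proof.
move=> AT; rewrite -[RHS](mean_cst 1); congr m.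
by apply/funext => x; rewrite indT.
Qed.

Lemma mu_le1 A : mu A <= 1.
Proof. by rewrite -(@mu_full (fun _ => True)) //; apply: mu_le. Qed.

Lemma mean_translates A s :
  m (fun z => \sum_(x <- s) ind R (A (x^-1 * z)%g)) = (size s)%:R * mu A.
Proof.
rewrite (@mean_sum _ s (fun x z => ind R (A (x^-1 * z)%g))).
  rewrite (eq_bigr (fun _ => mu A)) ?big_const_seq ?count_predT ?iter_addr_0.
    by rewrite mulr_natl.
  by move=> x _; rewrite (m_inv x (bounded_ind A)).
by move=> x; exact: bounded_ind.
Qed.

(** Pairwise disjointness of the translates [x A] for [x] in [s], where [A (x^-1 * z)] expresses
    that [z] lies in [x A]. *)
Fixpoint separated A s : Prop :=
  if s is x :: s' then
    (forall y z, y \in s' -> A (x^-1 * z)%g -> ~ A (y^-1 * z)%g) /\ separated A s'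
  else True.

(** The indicators of disjoint translates sum to at most [1] pointwise, and by invariance each has
    mean [mu A]. *)
Lemma separated_size A s : separated A s -> (size s)%:R * mu A <= 1.
Proof.
move=> sepA; rewrite -mean_translates -(mean_cst 1); apply: mean_le => [||z].
- by apply: bounded_sum => x; exact: bounded_ind.
- exact: bounded_cst.
elim: s sepA => [|x s IH] /= => [_|[xs /IH]]; first by rewrite big_nil.
rewrite big_cons; have [Ax _|Ax] := pselect (A (x^-1 * z)%g).
  rewrite indT // big_seq big1 ?addr0 // => y ys; rewrite indF //.
  exact: xs Ax.
by rewrite indF // add0r.
Qed.

Lemma separated_iota A (h : nat -> G) n :
  (forall i j z, (i < j < n)%N -> A ((h i)^-1 * z)%g -> ~ A ((h j)^-1 * z)%g) ->
  separated A [seq h i | i <- iota 0 n].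
Proof.
move=> sep; suff H k : (k <= n)%N -> separated A [seq h i | i <- iota (n - k) k].
  by rewrite -{1}(subnn n); apply: H.
elim: k => [//|k IH] kn /=; split.
  move=> y z /mapP[j]; rewrite mem_iota => jn ->; apply: sep.
  by move: jn; lia.
have -> : ((n - k.+1).+1 = n - k)%N by lia.
by apply: IH; lia.
Qed.

(** Were no disjoint family maximal, greedy extension would produce families of every size, against
    [separated_size]. *)
Lemma maximal_family P A : 0 < mu A -> exists s,
  [/\ forall x, x \in s -> P x, (size s)%:R * mu A <= 1
    & forall g, P g -> exists2 x, x \in s & exists z, A (x^-1 * z)%g /\ A (g^-1 * z)%g].
Proof.
move=> A_gt0; apply: contrapT => no_max.
have big n : exists s, [/\ forall x, x \in s -> P x, separated A s & size s = n].
  elim: n => [|n [s [sP sepA sn]]]; first by exists [::].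
  apply: contrapT => no_ext; apply: no_max; exists s.
  split=> //; first exact: separated_size.
  move=> g Pg; apply: contrapT => ng; apply: no_ext; exists (g :: s).
  split; rewrite /= ?sn //.
    by move=> x; rewrite inE => /orP[/eqP ->|/sP].
  by split=> // y z ys Ag Ay; apply: ng; exists y => //; exists z.
pose n := (Num.truncn (mu A)^-1).+1.
have [s [_ /separated_size + sn]] := big n.
rewrite sn -ler_pdivlMr // div1r => /(lt_le_trans (truncnS_gt _)).
by rewrite ltxx.
Qed.

(** Cosets that meet coincide, so a maximal disjoint family already covers [P]. Later uses need the
    representatives to lie in [P]. *)
Lemma coset_family P A : is_subgroup A -> 0 < mu A -> exists s,
  [/\ forall x, x \in s -> P x, (size s)%:R * mu A <= 1
    & forall g, P g -> exists2 x, x \in s & A (x^-1 * g)%g].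
Proof.
move=> [_ AM AV] /(maximal_family P)[s [sP sA smax]].
exists s; split=> // g /smax[x xs [z [Ax Ag]]]; exists x => //.
have -> : (x^-1 * g = (x^-1 * z) * (g^-1 * z)^-1)%g by gsimp.
by apply: AM => //; apply: AV.
Qed.

Lemma mu_cover A B s :
  (forall g, A g -> exists2 x, x \in s & B (x^-1 * g)%g) -> mu A <= (size s)%:R * mu B.
Proof.
move=> cov; rewrite -mean_translates; apply: mean_le => [||z].
- exact: bounded_ind.
- by apply: bounded_sum => x; exact: bounded_ind.
have [Az|/indF ->] := pselect (A z); last by apply: sumr_ge0 => x _; exact: ind_ge0.
have [x xs Bx] := cov _ Az; rewrite (indT Az) (big_rem x) //= indT //.
by rewrite lerDl; apply: sumr_ge0 => y _; exact: ind_ge0.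
Qed.

Lemma index_atmost_mu A (n : nat) : is_subgroup A -> 0 < mu A -> (mu A)^-1 < n.+1%:R ->
  index_atmost A n.
Proof.
move=> AG A0 An; have [s [_ sA cov]] := coset_family (fun _ => True) AG A0.
exists (size s), (fun i => nth 1%g s i); split.
  rewrite -ltnS -(ltr_nat R); apply: le_lt_trans An.
  by rewrite -[_^-1]mul1r ler_pdivlMr.
move=> g; have [x xs Ax] := cov g I.
have xi : (index x s < size s)%N by rewrite index_mem.
by exists (Ordinal xi); rewrite nth_index.
Qed.

(** [A] meets at most [1 / mu B] cosets of [B]; with representatives taken in [A], each piece is a
    translate of the intersection. *)
Lemma mu_inter A B : is_subgroup A -> is_subgroup B ->
  mu A * mu B <= mu (fun x => A x /\ B x).
Proof.
move=> [_ AM AV] BG; have [B0|] := ltP 0 (mu B); last first.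
  move=> B0; apply: le_trans (mu_ge0 _).
  by rewrite mulr_ge0_le0 // mu_ge0.
have [s [sA sB cov]] := coset_family A BG B0.
have AAB : mu A <= (size s)%:R * mu (fun x => A x /\ B x).
  apply: mu_cover => g Ag; have [x xs Bx] := cov _ Ag; exists x => //.
  by split=> //; apply: AM => //; apply/AV/sA.
have AB0 := mu_ge0 (fun x => A x /\ B x).
apply: le_trans (ler_wpM2r (ltW B0) AAB) _.
by rewrite mulrAC -[leRHS]mul1r ler_wpM2r.
Qed.

(** [A] and [b A] are disjoint subsets of [B]. *)
Lemma mu_proper A B b : is_subgroup A -> is_subgroup B ->
  (forall x, A x -> B x) -> B b -> ~ A b -> 2 * mu A <= mu B.
Proof.
move=> [_ AM AV] [_ BM BV] AB Bb nAb.
rewrite -(mean_translates A [:: 1; b]%g); apply: mean_le => [||z].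
- by apply: bounded_sum => x; exact: bounded_ind.
- exact: bounded_ind.
rewrite big_cons big_seq1 invg1 mul1g.
have [Az|/indF ->] := pselect (A z).
  rewrite (indT Az) (indT (AB _ Az)) indF ?addr0 // => Ab; apply: nAb.
  have -> : (b = z * (b^-1 * z)^-1)%g by gsimp.
  by apply: AM => //; apply: AV.
rewrite add0r; have [Ab|/indF -> ] := pselect (A (b^-1 * z)%g); last exact: ind_ge0.
rewrite (indT Ab) indT //; have -> : (z = b * (b^-1 * z))%g by gsimp.
by apply: BM => //; apply: AB.
Qed.

(** The mean is only left-invariant, so the argument goes through the index: conjugating a cover of
    [G] by at most [1 / mu A] cosets of [A] gives as many cosets of the conjugate. *)
Lemma mu_conj A g : is_subgroup A -> mu A <= mu (fun x => A (x ^ g)%g).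
Proof.
move=> AG; have [A0|A0] := ltP 0 (mu A); last exact: le_trans (mu_ge0 _).
have [s [_ sA cov]] := coset_family (fun _ => True) AG A0.
have := @mu_cover (fun _ => True) (fun x => A (x ^ g)%g) [seq x ^ g^-1 | x <- s]%g.
rewrite size_map mu_full // => /(_ _)/wrap[h _|le1].
  have [x xs Ax] := cov (h ^ g)%g I.
  exists (x ^ g^-1)%g; first exact: map_f.
  by rewrite conjMg conjVg conjgKV.
rewrite -[leLHS]mulr1; apply: le_trans (ler_wpM2l (ltW A0) le1) _.
by rewrite mulrCA mulrA ler_piMl ?mu_ge0.
Qed.

Lemma subgroup_commute (x : G) : is_subgroup (commute x).
Proof. by split; [exact: commute1|exact: commuteM|exact: commuteV]. Qed.

(** Pigeonhole: the [r + 1] translates of [A] by [1, x, ..., x ^+ r] cannot be disjoint, so some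
    [x ^+ j] with [0 < j <= r] lies in [A], and [j] divides the factorial. *)
Lemma power_mem A r x : is_subgroup A -> (0 < r)%N -> r%:R^-1 <= mu A ->
  A (x ^+ r`!)%g.
Proof.
move=> AG r0 rA.
suff [j /andP[j0 jr] Aj] : exists2 j, (0 < j <= r)%N & A (x ^+ j)%g.
  have /dvdnP[k ->] : (j %| r`!)%N by rewrite dvdn_fact // j0.
  by rewrite mulnC expgnA; apply: subgroupX.
apply: contrapT => no_j.
have /separated_size : separated A [seq (x ^+ i)%g | i <- iota 0 r.+1].
  apply: separated_iota => i j z /andP[ij jr] Ai Aj; apply: no_j.
  exists (j - i)%N; first by lia.
  have [_ AM AV] := AG.
  have -> : (x ^+ (j - i) = (x ^+ i)^-1 * z * ((x ^+ j)^-1 * z)^-1)%g.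
    by rewrite -{2}(subnKC (ltnW ij)) expgnDr; gsimp.
  by apply: AM => //; apply: AV.
rewrite size_map size_iota; have := ler_wpM2l (ler0n _ r.+1) rA.
move=> /le_trans h /h; rewrite ler_pdivrMr ?ltr0n // mul1r ler_nat ltnn.
by [].
Qed.

(** Orbit-stabiliser. Conjugation is a right action while the cosets [h C(x)] are left cosets, hence
    the inverses [h^-1]. *)
Lemma class_enum K x r : is_subgroup K -> (0 < r)%N -> r%:R^-1 <= mu (commute x) ->
  exists S, (size S <= r)%N /\ forall y, (y \in S) <-> class_of K x y.
Proof.
move=> [K1 KM KV] r0 rx; have x0 : 0 < mu (commute x).
  by apply: lt_le_trans rx; rewrite invr_gt0 ltr0n.
have [s [sK sx cov]] := coset_family K (subgroup_commute x) x0.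
exists [seq x ^ h^-1 | h <- s]%g; split.
  rewrite size_map -(ler_nat R) -[leRHS]invrK -[leRHS]mul1r.
  rewrite ler_pdivlMr ?invr_gt0 ?ltr0n //.
  by apply: le_trans sx; apply: ler_wpM2l.
move=> y; split=> [/mapP[h /sK Kh ->]|[g Kg ->]].
  by exists (h^-1)%g => //; apply: KV.
have [h hs xh] := cov _ (KV _ Kg); apply/mapP; exists h => //.
have /conjg_fixP : [~ x, h^-1 * g^-1]%g == 1%g by apply/commgP.
by rewrite conjgM => xE; rewrite -{1}xE conjgKV.
Qed.

End Means.

(** * Killing commutators one element at a time *)

Section CommutatorKillingChains.
Local Open Scope group_scope.
Variables (G : groupType) (K : G -> Prop).
Hypothesis K_group : is_subgroup K.
Implicit Types (N : G -> Prop) (g h k x y : G) (s S : seq G).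

Let K1 : K 1. Proof. by case: K_group. Qed.
Let KM x y : K x -> K y -> K (x * y). Proof. by case: K_group => _ + _; apply. Qed.
Let KV x : K x -> K x^-1. Proof. by case: K_group => _ _; apply. Qed.

Definition normal_in N : Prop :=
  [/\ is_subgroup N, (forall g, N g -> K g) & forall g k, N g -> K k -> N (g ^ k)].

Lemma class_of_self x : class_of K x x.
Proof. by exists 1; rewrite ?conjg1. Qed.

Lemma class_ofJ x y k : class_of K x y -> K k -> class_of K x (y ^ k).
Proof. by move=> [g Kg ->] Kk; exists (g * k); rewrite ?conjgM //; exact: KM. Qed.

Lemma normal_in_class x : K x -> normal_in (class_quotients K x).
Proof.
move=> Kx; split.
- by apply: gen_subgroup => _ [y [z [yx zx ->]]]; exists z, y; rewrite invgF.
- case: K_group => _ _ _; apply: gen_min => // _ [y [z [[g Kg ->] [h Kh ->] ->]]].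
  by apply/KM/KV; apply: subgroupJ.
- move=> g k Ng Kk; apply: genJ Ng => _ [y [z [yx zx ->]]].
  exists (y ^ k), (z ^ k); rewrite conjMg conjVg.
  by split=> //; apply: class_ofJ.
Qed.

(** The product of the subgroups [[K, x]]. For entries in [K] it is normal in [K], and all entries
    become central modulo it. *)
Fixpoint quotients_seq s : G -> Prop :=
  if s is x :: s' then
    fun g => exists a b, [/\ class_quotients K x a, quotients_seq s' b & g = a * b]
  else fun g => g = 1.

Lemma normal_in_seq s : (forall x, x \in s -> K x) -> normal_in (quotients_seq s).
Proof.
elim: s => [|x s IH] sK /=.
  split.
  - by split=> [//|x y -> ->|x ->]; rewrite ?mulg1 ?invg1.
  - by move=> g ->.
  - by move=> g k -> _; rewrite conj1g.
have [|[A1 AM AV] AK AJ] := @normal_in_class x; first by apply/sK/mem_head.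
have [|[B1 BM BV] BK BJ] := IH; first by move=> y ys; apply/sK; rewrite inE ys orbT.
split; first split.
- by exists 1, 1; rewrite mulg1.
- move=> _ _ [a [b [Aa Bb ->]]] [a' [b' [Aa' Bb' ->]]].
  exists (a * a' ^ b^-1), (b * b'); split; last by gsimp.
    by apply: AM => //; apply: AJ => //; apply/KV/BK.
  exact: BM.
- move=> _ [a [b [Aa Bb ->]]]; exists (a^-1 ^ b), b^-1; split; last by gsimp.
    by apply: AJ; [exact: AV|exact: BK].
  exact: BV.
- by move=> _ [a [b [Aa Bb ->]]]; apply: KM; [exact: AK|exact: BK].
- move=> _ k [a [b [Aa Bb ->]]] Kk; exists (a ^ k), (b ^ k).
  by rewrite conjMg; split; [exact: AJ|exact: BJ|].
Qed.

Lemma quotients_seq_commg x s g : (forall y, y \in x :: s -> K y) -> K g ->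
  quotients_seq (x :: s) [~ g, x].
Proof.
move=> sK Kg; have Kx : K x by apply/sK/mem_head.
have [_ _ AJ] := normal_in_class Kx.
have [[B1 _ _] _ _] : normal_in (quotients_seq s).
  by apply: normal_in_seq => y ys; apply: sK; rewrite inE ys orbT.
exists [~ g, x], 1; rewrite mulg1; split=> //.
have -> : [~ g, x] = (x / x ^ g) ^ (x ^ g) by rewrite /commg; gsimp.
apply: AJ; last exact: subgroupJ.
apply: gen_incl; exists x, (x ^ g); split=> //; first exact: class_of_self.
by exists g.
Qed.

Lemma quotients_seq_cons x s g :
  K x -> quotients_seq s g -> quotients_seq (x :: s) g.
Proof.
by move=> Kx Ng; exists 1, g; rewrite mul1g; split=> //; exact: gen1.
Qed.

Lemma quotients_seq_covered s q :
  (forall x, x \in s -> covered (class_quotients K x) q) ->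
  covered (quotients_seq s) (q ^ size s).
Proof.
elim: s => [_|x s IH sq] /=; first by exists [:: 1]; split=> // g ->; rewrite mem_head.
have [l [lq lP]] := sq x (mem_head _ _).
have [|l' [l'q l'P]] := IH; first by move=> y ys; apply: sq; rewrite inE ys orbT.
exists [seq a * b | a <- l, b <- l']; split.
  by rewrite size_allpairs expnS leq_mul.
move=> _ [a [b [/lP al /l'P bl ->]]].
by apply/allpairsP; exists (a, b).
Qed.

(** The preimage in [K] of the centraliser of [g] in [K / N]. *)
Definition commute_mod N g : G -> Prop := fun h => K h /\ N [~ g, h].

Lemma commute_mod_subgroup N g : normal_in N -> K g -> is_subgroup (commute_mod N g).
Proof.
move=> [[N1 NM NV] NK NJ] Kg; split.
- by split=> //; rewrite commg1.
- move=> x y [Kx Nx] [Ky Ny]; split; first exact: KM.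
  have -> : [~ g, x * y] = [~ g, y] * [~ g, x] ^ y by rewrite /commg; gsimp.
  by apply: NM => //; apply: NJ.
- move=> x [Kx Nx]; split; first exact: KV.
  have -> : [~ g, x^-1] = ([~ g, x] ^ x^-1)^-1 by rewrite /commg; gsimp.
  by apply/NV/NJ => //; apply: KV.
Qed.

(** The head is the element killed last: it must be non-central modulo what the tail has killed. *)
Fixpoint chain (X : G -> Prop) s : Prop :=
  if s is x :: s' then
    [/\ chain X s', X x & exists2 g, K g & ~ quotients_seq s' [~ g, x]]
  else True.

(** Counts the steps at which [g] fails to commute with the element about to be killed, so that its
    centraliser grows. *)
Fixpoint growth s g : nat :=
  if s is x :: s' then
    (`[< K g /\ ~ quotients_seq s' [~ g, x] >] + growth s' g)%N
  else 0%N.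

Lemma growth_out s g : ~ K g -> growth s g = 0%N.
Proof. by move=> Kg; elim: s => //= x s ->; rewrite asboolF // => -[]. Qed.

Lemma growth_le s g : (growth s g <= size s)%N.
Proof. by elim: s => //= x s IH; case: asboolP => _; lia. Qed.

Lemma chain_mem X s x : chain X s -> x \in s -> X x.
Proof. by elim: s => //= y s IH [/IH sX Xy _]; rewrite inE => /orP[/eqP ->|/sX]. Qed.

End CommutatorKillingChains.

(** * Bounding the length of a chain *)

Section ChainLength.
Variables (R : realType) (G : groupType) (m : (G -> R) -> R).
Hypotheses (m_mean : is_mean m) (m_inv : left_invariant m).
Variables (K X : G -> Prop).
Hypotheses (K_group : is_subgroup K) (X_sub : forall x, X x -> K x).
Implicit Types (s : seq G) (g : G).

(* Whenever [g] fails to commute with the next element of the chain, its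
   centraliser modulo the chain grows properly, hence doubles in measure. *)
Lemma mu_growth s g : (forall x, x \in s -> K x) -> K g ->
  mu m (fun h => K h /\ commute g h) * 2 ^+ growth K s g <=
  mu m (commute_mod K (quotients_seq K s) g).
Proof.
move=> + Kg; elim: s => [_|x s IH sK] /=.
  rewrite expr0 mulr1; apply: mu_le => // h [Kh gh]; split=> //=.
  exact/eqP/commgP.
have sK' y : y \in s -> K y by move=> ys; apply: sK; rewrite inE ys orbT.
have Kx : K x by apply/sK/mem_head.
have sub h : commute_mod K (quotients_seq K s) g h ->
    commute_mod K (quotients_seq K (x :: s)) g h.
  by move=> [Kh Nh]; split=> //; exact: quotients_seq_cons.
case: asboolP => [[_ ngx]|_]; rewrite ?add0n; last first.
  by apply: le_trans (IH sK') _; exact: mu_le.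
rewrite add1n exprS mulrCA.
apply: (@le_trans _ _ (2 * mu m (commute_mod K (quotients_seq K s) g))).
  by rewrite ler_wpM2l //; exact: IH.
apply: (mu_proper m_mean m_inv (b := x)) => //.
- by apply: commute_mod_subgroup => //; apply: normal_in_seq.
- by apply: commute_mod_subgroup => //; apply: (normal_in_seq K_group (s := x :: s)).
- by split=> //; apply: quotients_seq_commg.
- by case.
Qed.

(** The new element [x] is not central modulo the tail, so its centraliser there is proper and at
    least half of [K] fails to commute with it. Each step thus adds at least [mu m K / 2] to the
    mean of [growth]. *)
Lemma mean_growth s : chain K X s ->
  (size s)%:R * mu m K <= 2 * m (fun g => (growth K s g)%:R).
Proof.
have bounded_growth t : Defs.bounded_fun (fun g => (growth K t g)%:R : R).
  apply: (@bounded_range _ _ _ (size t)%:R) => g.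
  by rewrite ler0n ler_nat growth_le.
elim: s => [_|x s IH /= [chs Xx [g0 Kg0 ng0]]].
  by rewrite mul0r /= mean_cst // mulr0.
have sK y : y \in s -> K y by move/(chain_mem chs)/X_sub.
have Ngrp := normal_in_seq K_group sK.
pose B g := K g /\ ~ quotients_seq K s [~ g, x]%g.
have -> : (fun g => (`[< K g /\ ~ quotients_seq K s [~ g, x]%g >] + growth K s g)%:R)
    = (fun g => ind R (B g) + (growth K s g)%:R).
  by apply/funext => g; rewrite natrD /ind /B; case: pselect => h;
    [rewrite asboolT|rewrite asboolF].
rewrite meanD //; last exact: bounded_ind.
rewrite -natr1 mulrDl mul1r mulrDr addrC lerD ?IH //.
have NV g h : quotients_seq K s [~ g, h]%g -> quotients_seq K s [~ h, g]%g.
  by case: Ngrp => -[_ _ NV] _ _ /NV; rewrite invgR.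
have : 2 * mu m (commute_mod K (quotients_seq K s) x) <= mu m K.
  apply: (mu_proper m_mean m_inv (b := g0)) => //.
  - by apply: commute_mod_subgroup => //; apply: X_sub.
  - by move=> h [].
  - by case=> _ /NV.
have : mu m K <= mu m (commute_mod K (quotients_seq K s) x) + mu m B.
  rewrite /mu -meanD //; [|exact: bounded_ind..].
  apply: mean_le => // [||g]; first exact: bounded_ind.
    by apply: boundedD; exact: bounded_ind.
  have [Kg|/indF ->] := pselect (K g); last by rewrite addr_ge0 ?ind_ge0.
  rewrite (indT _ Kg); have [N|N] := pselect (quotients_seq K s [~ g, x]%g).
    by rewrite indT ?lerDl ?ind_ge0 //; split=> //; exact: NV.
  by rewrite [in X in _ + X]indT ?lerDr ?ind_ge0.
rewrite -/(mu m B); lra.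
Qed.

(** Double counting: measures stay at most [1], so each [g] undergoes at most [W] doublings, and the
    mean of [growth] is at most [W * mu m K]; compare with [mean_growth]. *)
Lemma chain_size s W : 0 < mu m K ->
  (forall g, K g -> 1 <= mu m (fun h => K h /\ commute g h) * 2 ^+ W) ->
  chain K X s -> (size s <= 2 * W)%N.
Proof.
move=> K0 KW chs; have sK y : y \in s -> K y by move/(chain_mem chs)/X_sub.
have gW g : K g -> (growth K s g <= W)%N.
  move=> Kg; have := le_trans (mu_growth sK Kg) (mu_le1 m_mean _).
  move=> /le_trans/(_ (KW _ Kg)); rewrite ler_pM2l; first last.
    rewrite lt_neqAle mu_ge0 // andbT eq_sym; apply/eqP => mu0.
    by have := KW _ Kg; rewrite mu0 mul0r ler10.
  by rewrite ler_eXn2l // ltr1n.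
have mF : m (fun g => (growth K s g)%:R) <= W%:R * mu m K.
  rewrite -(meanZ m_mean); last exact: bounded_ind.
  apply: mean_le => // [||g].
  - apply: (@bounded_range _ _ _ (size s)%:R) => g.
    by rewrite ler0n ler_nat growth_le.
  - by apply: boundedZ; exact: bounded_ind.
  have [Kg|nKg] := pselect (K g); last by rewrite growth_out // indF // mulr0.
  by rewrite indT // mulr1 ler_nat gW.
have le2 : 2 * m (fun g => (growth K s g)%:R) <= (2 * W)%:R * mu m K.
  by rewrite natrM -mulrA ler_wpM2l.
by have := le_trans (mean_growth chs) le2; rewrite ler_pM2r // ler_nat.
Qed.

End ChainLength.

(** * Word balls and the commuting probability *)

Section CommutingProbability.
Variables (R : realType) (G : groupType) (m : (G -> R) -> R).
Hypotheses (m_mean : is_mean m) (m_inv : left_invariant m).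
Implicit Types (X : G -> Prop) (x y g h : G) (r N : nat).

Definition ball X j : G -> Prop := fun g =>
  exists w : seq G, [/\ size w = j, forall x, x \in w -> X x & g = (\prod_(x <- w) x)%g].

Lemma ball1 X x : X x -> ball X 1 x.
Proof.
move=> Xx; exists [:: x]; rewrite big_seq1; split=> // y.
by rewrite inE => /eqP ->.
Qed.

Lemma ballM X i j g h : ball X i g -> ball X j h -> ball X (i + j) (g * h)%g.
Proof.
move=> [v [<- vX ->]] [w [<- wX ->]]; exists (v ++ w).
rewrite size_cat big_cat; split=> // x.
by rewrite mem_cat => /orP[/vX|/wX].
Qed.

Lemma ball_le X i j g : X 1%g -> (i <= j)%N -> ball X i g -> ball X j g.
Proof.
move=> X1 /subnKC <- gi; rewrite -[g]mulg1; apply: ballM => //.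
exists (nseq (j - i) 1%g); rewrite size_nseq big_nseq iter_mulg_1 expg1n.
by split=> // x; rewrite mem_nseq => /andP[_ /eqP ->].
Qed.

Lemma gen_ball_stable X j : X 1%g -> (forall g, ball X j.+1 g -> ball X j g) ->
  forall g, gen X g -> ball X j g.
Proof.
move=> X1 stable _ [w [wX ->]]; elim: w wX => [|x w IH] wX.
  rewrite big_nil; apply: (ball_le X1 (leq0n j)).
  by exists [::]; rewrite big_nil.
rewrite big_cons; apply: stable; apply: (@ballM _ 1).
  by apply/ball1/wX/mem_head.
by apply: IH => y yw; apply: wX; rewrite inE yw orbT.
Qed.

(* If the balls were still growing at radius [3 * N], elements [h i] appearing
   at radius [3 * i + 1] would give [N + 1] disjoint translates of [X]. *)
Lemma gen_ball X N : X 1%g -> (forall x, X x -> X x^-1%g) -> 1 < N.+1%:R * mu m X ->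
  forall g, gen X g -> ball X (3 * N) g.
Proof.
move=> X1 XV NX g Xg; apply: contrapT => ng.
have /choice[h hP] : forall i, exists y, (i <= N)%N ->
    ball X (3 * i).+1 y /\ ~ ball X (3 * i) y.
  move=> i.
  have [iN|iN] := leqP i N; last by exists 1%g.
  apply: contrapT => no_h; apply: ng.
  have le3 : (3 * i <= 3 * N)%N by rewrite leq_mul2l.
  apply: (ball_le X1 le3); apply: (gen_ball_stable X1) => // y yb.
  by apply: contrapT => ny; apply: no_h; exists y.
have /(separated_size m_mean m_inv) : separated X [seq h i | i <- iota 0 N.+1].
  apply: separated_iota => i j z /andP[ij jN] Xi Xj.
  have [_ nj] := hP j jN; apply: nj.
  have iN : (i <= N)%N by lia.
  have [hi _] := hP i iN.
  (* A common point [z] puts [h j] within radius [(3 * i + 1) + 2 = 3 * (i + 1) <= 3 * j], where it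
     was chosen not to be. *)
  have -> : (h j = h i * ((h i)^-1 * z) * ((h j)^-1 * z)^-1)%g by gsimp.
  apply: (@ball_le _ ((3 * i).+1 + 1 + 1)) => //; first by lia.
  by apply: ballM; [apply: ballM => //; exact: ball1|apply/ball1/XV].
by rewrite size_map size_iota leNgt NX.
Qed.

(** The centraliser of a product contains the intersection of the centralisers of its factors; by
    [mu_inter] each letter costs a factor [d]. *)
Lemma mu_ball X K j g (d : R) : is_subgroup K -> 0 <= d ->
  (forall x, X x -> d <= mu m (commute x)) -> ball X j g ->
  mu m K * d ^+ j <= mu m (fun h => K h /\ commute g h).
Proof.
move=> KG d0 Xd [w [<- wX ->]] {j g}; elim: w wX => [|x w IH] wX.
  rewrite expr0 mulr1 big_nil; apply: mu_le => // h Kh.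
  by split=> //; apply/commute_sym/commute1.
set g := (\prod_(y <- w) y)%g in IH.
have KgG : is_subgroup (fun h => K h /\ commute g h).
  have [K1 KM KV] := KG; split=> [|a b [Ka ga] [Kb gb]|a [Ka ga]].
  - by split=> //; exact: commute1.
  - by split; [exact: KM|exact: commuteM].
  - by split; [exact: KV|exact: commuteV].
apply: (@le_trans _ _ (mu m (fun h => K h /\ commute g h) * mu m (commute x))).
  rewrite exprS mulrCA mulrC; apply: ler_pM => //.
  - by rewrite mulr_ge0 ?mu_ge0 // exprn_ge0.
  - by apply: IH => y yw; apply: wX; rewrite inE yw orbT.
  - by apply/Xd/wX/mem_head.
apply: le_trans (mu_inter m_mean m_inv KgG (subgroup_commute x)) _.
apply: mu_le => // h [[Kh gh] xh]; split=> //.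
by rewrite big_cons; apply/commute_sym/commuteM; apply: commute_sym.
Qed.

Lemma bounded_mu_commute : Defs.bounded_fun (fun x => mu m (commute x)).
Proof.
by apply: (@bounded_range _ _ _ 1) => x; rewrite mu_ge0 // mu_le1.
Qed.

Lemma dc_mu : dc m = m (fun x => mu m (commute x)).
Proof. by []. Qed.

Lemma dc_le1 : dc m <= 1.
Proof.
rewrite dc_mu -(mean_cst m_mean 1); apply: mean_le => // [||x].
- exact: bounded_mu_commute.
- exact: bounded_cst.
- exact: mu_le1.
Qed.

(** Markov's argument: bound the measure of the centraliser by [1] above the threshold and by [d]
    below it. *)
Lemma dc_le_threshold (d : R) : 0 <= d -> dc m <= mu m (fun x => d <= mu m (commute x)) + d.
Proof.
move=> d0; rewrite dc_mu -[X in _ <= _ + X](mean_cst m_mean) /mu -meanD //; first last.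
- exact: bounded_cst.
- exact: bounded_ind.
apply: mean_le => // [||x]; first exact: bounded_mu_commute.
  by apply: boundedD; [exact: bounded_ind|exact: bounded_cst].
rewrite -/(mu m (commute x)); have [dx|/ltW xd] := leP d (mu m (commute x)).
  by rewrite indT //; apply: le_trans (mu_le1 m_mean _) _; rewrite lerDl.
by apply: le_trans xd _; rewrite lerDr ind_ge0.
Qed.

Lemma dc_le_centre : dc m <= 1 / 2 + mu m (@centre G) / 2.
Proof.
have -> : 1 / 2 + mu m (@centre G) / 2 = m (fun x => 1 / 2 + 1 / 2 * ind R (centre x)).
  rewrite meanD //; [|exact: bounded_cst|by apply: boundedZ; exact: bounded_ind].
  rewrite mean_cst // meanZ //; last exact: bounded_ind.
  by rewrite /mu; congr (_ + _); rewrite [RHS]mulrC div1r.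
rewrite dc_mu; apply: mean_le => // [||x]; first exact: bounded_mu_commute.
  apply: boundedD; first exact: bounded_cst.
  by apply: boundedZ; exact: bounded_ind.
have [Zx|nZx] := pselect (centre x).
  by rewrite indT //; have := mu_le1 m_mean (commute x); lra.
rewrite indF //; have [y nxy] : exists y, ~ commute x y by apply/existsNP.
have : 2 * mu m (commute x) <= mu m (fun _ => True).
  by apply: (mu_proper m_mean m_inv (b := y)) => //; exact: subgroup_commute.
by have := mu_le1 m_mean (fun _ : G => True); lra.
Qed.

Lemma centre_subgroup : is_subgroup (@centre G).
Proof.
split=> [y|x y Zx Zy z|x Zx z]; first by rewrite mul1g mulg1.
- by apply/commute_sym/commuteM; apply: commute_sym; [exact: Zx|exact: Zy].
- by apply/commute_sym/commuteV/commute_sym/Zx.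
Qed.

(** The centre has measure above [1 / 4], whereas non-commuting [x] and [y] would give four disjoint
    cosets of it, those of [1], [x], [y] and [x * y]. *)
Lemma abelian_of_dc : 5 / 8 < dc m -> abelian_grp G.
Proof.
move=> dc58 x y; apply: contrapT => nxy.
have Z4 : 1 < 4%:R * mu m (@centre G) by have := dc_le_centre; lra.
have [Z1 ZM ZV] := centre_subgroup.
have nx : ~ centre x by move=> Zx; exact: nxy.
have ny : ~ centre y by move=> /(_ x) Zy; exact: nxy.
have ZJ (u v : G) : centre (u ^ v)%g -> centre u.
  move=> Zu; suff -> : u = (u ^ v)%g by [].
  by rewrite -{1}[u](conjgK v) [LHS]conjgE invgK Zu mulVKg.
have meet (u v z : G) : centre (u^-1 * z)%g -> centre (v^-1 * z)%g -> centre (u^-1 * v)%g.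
  move=> Zu Zv; have -> : (u^-1 * v = (u^-1 * z) * (v^-1 * z)^-1)%g by gsimp.
  exact: ZM Zu (ZV _ Zv).
have : separated (@centre G) [:: 1; x; y; x * y]%g.
  rewrite /=; do ! split=> //; move=> v z.
  - rewrite !inE => /or3P[]/eqP -> /meet/[apply]; rewrite invg1 mul1g //.
    by move=> /(_ x)/esym; rewrite -mulgA => /mulgI; exact: nxy.
  - rewrite !inE => /orP[]/eqP -> /meet/[apply]; last by rewrite mulKg.
    move=> /(_ x); rewrite mulVKg -mulgA => xy; apply: nxy.
    by rewrite -{1}xy mulVKg.
  - rewrite !inE => /eqP -> /meet/[apply]; rewrite -conjgE.
    by move/ZJ.
by move=> /(separated_size m_mean m_inv); rewrite leNgt Z4.
Qed.

Lemma centre_index_of_dc (eps : R) : 0 < eps -> 1 / 2 + eps <= dc m ->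
  exists n : nat, n%:R <= eps^-1 /\ index_atmost (@centre G) n.
Proof.
move=> eps0 dce; have Ze : 2 * eps <= mu m (@centre G) by have := dc_le_centre; lra.
have Z0 : 0 < mu m (@centre G) by lra.
exists (Num.truncn (mu m (@centre G))^-1); split; last first.
  by apply: (index_atmost_mu m_mean m_inv centre_subgroup Z0); exact: truncnS_gt.
have := truncn_le (mu m (@centre G))^-1; rewrite invr_ge0 (ltW Z0) => /le_trans; apply.
by rewrite lef_pV2 ?posrE //; lra.
Qed.

(** * The subgroup generated by elements with large centraliser *)

Section LargeDegree.
Variables (N r : nat).
Let X x := r%:R^-1 <= mu m (commute x).
Hypotheses (r_large : (N < r)%N) (X_large : N.+1%:R^-1 < mu m X).
Let K := gen X.

Lemma threshold_set1 : X 1%g.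
Proof.
rewrite /X mu_full //; last by move=> h; apply/commute_sym/commute1.
by rewrite invf_le1 ?ler1n ?ltr0n; case: r r_large.
Qed.

Lemma threshold_setV x : X x -> X x^-1%g.
Proof.
rewrite /X => /le_trans; apply; apply: mu_le => // h xh.
exact/commute_sym/commuteV/commute_sym.
Qed.

Lemma threshold_setJ x g : X x -> X (x ^ g)%g.
Proof.
rewrite /X => /le_trans; apply.
apply: le_trans (mu_conj m_mean m_inv g^-1 (subgroup_commute x)) _.
apply: mu_le => // h xh; rewrite -[h](conjgKV g).
by rewrite /commute -!conjMg xh.
Qed.

Let K_group : is_subgroup K. Proof. exact/gen_subgroup/threshold_setV. Qed.
Let X_sub x : X x -> K x. Proof. exact: gen_incl. Qed.

Let K_large : N.+1%:R^-1 < mu m K.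
Proof. by apply: lt_le_trans X_large _; apply: mu_le. Qed.

(** One factor [r^-1] bounds the measure of [K] and one comes from each of the [3 * N] letters of
    [g]; then [r <= 2 ^ r]. *)
Lemma mu_commute_threshold g : K g ->
  1 <= mu m (fun h => K h /\ commute g h) * 2 ^+ (r * (3 * N).+1).
Proof.
move=> Kg; have r0 : 0 < r%:R :> R by rewrite ltr0n; case: r r_large.
have /(mu_ball (d := r%:R^-1) K_group) : ball X (3 * N) g.
  apply: gen_ball Kg; [exact: threshold_set1|exact: threshold_setV|].
  by rewrite -ltr_pdivrMl ?ltr0n // mulr1.
rewrite invr_ge0 => /(_ (ltW r0) (fun x Xx => Xx)) Kball.
have Kr : r%:R^-1 <= mu m K.
  have Nr : N.+1%:R <= r%:R :> R by rewrite ler_nat.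
  apply: le_trans (ltW K_large).
  by rewrite lef_pV2 // posrE ltr0n.
have : r%:R^-1 ^+ (3 * N).+1 <= mu m (fun h => K h /\ commute g h).
  by apply: le_trans Kball; rewrite exprS; apply: ler_wpM2r => //;
    rewrite exprn_ge0 // invr_ge0 ltW.
rewrite exprVn => rK; rewrite exprM.
have r2 : r%:R ^+ (3 * N).+1 <= (2 ^+ r) ^+ (3 * N).+1 :> R.
  have r2 : r%:R <= 2 ^+ r :> R by rewrite -natrX ler_nat ltnW // ltn_expl.
  by apply: lerXn2r r2; rewrite nnegrE ?exprn_ge0 // ltW.
rewrite -[leLHS](@mulVf _ (r%:R ^+ (3 * N).+1)) ?gt_eqF ?exprn_gt0 //.
by apply: ler_pM; rewrite ?invr_ge0 ?exprn_ge0 // ltW.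
Qed.

(** Chains have bounded length, so some chain cannot be extended. Modulo its product every element
    of [X] is central in [K], and [X] generates [K]. *)
Lemma commutators_covered : exists L : G -> Prop,
  [/\ is_subgroup L, forall x y, K x -> K y -> L [~ x, y]%g
    & covered L ((r`! ^ r) ^ (2 * (r * (3 * N).+1)))].
Proof.
set W := (r * (3 * N).+1)%N.
have r0 : (0 < r)%N by case: r r_large.
have K0 : 0 < mu m K by apply: lt_trans K_large; rewrite invr_gt0 ltr0n.
have bound s : chain K X s -> (size s <= 2 * W)%N.
  by apply: (chain_size m_mean m_inv) => //; exact: mu_commute_threshold.
have [s [chs smax]] : exists s, chain K X s /\
    forall x g, X x -> K g -> quotients_seq K s [~ g, x]%g.
  apply: contrapT => no_max.
  have big n : exists s, chain K X s /\ size s = n.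
    elim: n => [|n [s [chs sn]]]; first by exists [::].
    apply: contrapT => no_ext; apply: no_max; exists s; split=> // x g Xx Kg.
    apply: contrapT => ngx; apply: no_ext; exists (x :: s); split; last by rewrite /= sn.
    by split=> //; exists g.
  have [s [/bound + sn]] := big (2 * W).+1.
  by rewrite sn ltnn.
have sX x : x \in s -> X x by exact: (chain_mem chs).
have Lnorm : normal_in K (quotients_seq K s).
  by apply: normal_in_seq => // x /sX/X_sub.
exists (quotients_seq K s); split; first by case: Lnorm.
  move=> x y Kx Ky.
  have [C1 CM _] := commute_mod_subgroup K_group Lnorm Kx.
  suff [] : commute_mod K (quotients_seq K s) x y by [].
  apply: gen_min Ky => // z Xz; split; first exact: X_sub.
  exact: smax.
have cov : covered (quotients_seq K s) ((r`! ^ r) ^ size s).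
  apply: quotients_seq_covered => x /sX Xx.
  have [S [Sr SE]] := class_enum m_mean m_inv K_group r0 Xx.
  have [|l [lS lP]] := class_quotients_covered K_group (X_sub Xx) SE (fact_gt0 r).
    (* Every [y] in [X] has a centraliser of measure at least [r^-1], so [power_mem] puts [x ^+ r!]
       in it; hence this power commutes with all of [K]. *)
    move=> g Kg; suff : commute (x ^+ r`!)%g g by [].
    apply: gen_min Kg => [|a b|y Xy]; [exact: commute1|exact: commuteM|].
    by apply/commute_sym; exact: (power_mem m_mean m_inv x (subgroup_commute y)).
  exists l; split=> //; apply: leq_trans lS _.
  by rewrite leq_pexp2l ?fact_gt0.
have [l [ls lP]] := cov; exists l; split=> //; apply: leq_trans ls _.
by rewrite leq_pexp2l ?expn_gt0 ?fact_gt0 // bound.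
Qed.

End LargeDegree.
End CommutingProbability.

(** * Numerical estimates *)

Section Bounds.
Variable R : realType.

Lemma fact_le_expn n : (n`! <= n ^ n)%N.
Proof.
elim: n => // n IH; rewrite factS expnS leq_mul2l /=.
by apply: leq_trans IH _; case: n => // n; rewrite leq_exp2r.
Qed.

Lemma fact_expn_le_expR r e :
  ((r`! ^ r) ^ e)%:R <= expR (r%:R * (r * r * e)%:R) :> R.
Proof.
apply: (@le_trans _ _ (r%:R ^+ (r * r * e))).
  rewrite -natrX ler_nat -!expnM -mulnA.
  by rewrite (expnM r r); case: (r * e)%N => // k; rewrite leq_exp2r // fact_le_expn.
rewrite mulrC -mulr_natl mulr_natl expRM_natl.
apply: lerXn2r; rewrite ?nnegrE ?expR_ge0 ?ler0n //.
by apply: le_trans (expR_ge1Dx _); rewrite lerDr.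
Qed.

(** With [b = a^-1 >= 1] one has [N < 2 * b], hence [r <= 7 * b ^+ 2] and [3 * N + 1 <= 7 * b]. The
    left side is then at most [2 * 7 ^+ 5 * b ^+ 9], and the exponent [9] is enlarged so that one
    constant serves twice. *)
Lemma exponent_bound (a : R) N r : 0 < a -> a <= 1 -> N%:R < a^-1 + 1 ->
  r = (N * N.+1).+1 ->
  r%:R * (r * r * (2 * (r * (3 * N).+1)))%:R <=
  2 * 7 ^+ 5 * a `^ (- (2 * 7 ^+ 5)).
Proof.
move=> a0 a1 + rN; set b := a^-1 => Nb.
have b1 : 1 <= b by rewrite invf_ge1.
have N0 : 0 <= N%:R :> R by [].
have r7 : r%:R <= 7 * b ^+ 2.
  by rewrite rN -natr1 natrM -natr1; nra.
have N7 : (3 * N).+1%:R <= 7 * b by rewrite -natr1 natrM; lra.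
have b0 : 0 <= b by lra.
apply: (@le_trans _ _ (2 * 7 ^+ 5 * b ^+ 9)).
  have : r%:R ^+ 4 * (3 * N).+1%:R <= (7 * b ^+ 2) ^+ 4 * (7 * b).
    apply: ler_pM => //.
    by apply: lerXn2r; rewrite ?nnegrE // mulr_ge0 // exprn_ge0.
  have -> : r%:R * (r * r * (2 * (r * (3 * N).+1)))%:R =
      2 * (r%:R ^+ 4 * (3 * N).+1%:R) :> R by rewrite !natrM; ring.
  have -> : 2 * 7 ^+ 5 * b ^+ 9 = 2 * ((7 * b ^+ 2) ^+ 4 * (7 * b)) by ring.
  by rewrite ler_pM2l.
rewrite ler_wpM2l ?mulr_ge0 ?exprn_ge0 // powRN exprVn lef_pV2 ?posrE ?powR_gt0 ?exprn_gt0 //.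
rewrite -(powR_mulrn 9 (ltW a0)); apply: ger_powR; first by rewrite a0.
by lra.
Qed.

Lemma card_atmost_covered (G : groupType) (H : G -> Prop) k (c : R) :
  covered H k -> k%:R <= c -> card_atmost H c.
Proof.
move=> [l [lk lH]] kc; exists (size l), (fun i => nth 1%g l i).
split; first by apply: le_trans kc; rewrite ler_nat.
move=> h /lH hl; have hi : (index h l < size l)%N by rewrite index_mem.
by exists (Ordinal hi); rewrite nth_index.
Qed.

End Bounds.

(** * The derived subgroup *)

Section DerivedSubgroup.
Local Open Scope group_scope.
Variables (G : groupType) (K : G -> Prop).
Hypothesis K_group : is_subgroup K.

Definition derived : G -> Prop :=
  gen (fun d => exists x y, [/\ K x, K y & d = x^-1 * y^-1 * x * y]).

Lemma derived_subgroup : is_subgroup derived.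
Proof.
apply: gen_subgroup => _ [x [y [Kx Ky ->]]]; exists y, x.
by split=> //; gsimp.
Qed.

Lemma derived_normal : (forall g x, K x -> K (x ^ g)) -> is_normal derived.
Proof.
move=> KJ; split; first exact: derived_subgroup.
move=> g x Dx; rewrite -mulgA -conjgE.
apply: genJ Dx => _ [y [z [Ky Kz ->]]]; exists (y ^ g), (z ^ g).
by split; [exact: KJ|exact: KJ|rewrite !conjMg !conjVg].
Qed.

Lemma derived_min L : is_subgroup L -> (forall x y, K x -> K y -> L [~ x, y]) ->
  forall g, derived g -> L g.
Proof.
move=> [L1 LM _] LK; apply: gen_min => // _ [x [y [Kx Ky ->]]].
by have := LK _ _ Kx Ky; rewrite /commg conjgE !mulgA.
Qed.

End DerivedSubgroup.

(** * Assembling the three statements *)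

Theorem theorem1p16 (R : realType) :
  (forall (G : groupType) (m : (G -> R) -> R),
      is_mean m -> left_invariant m ->
      (5 / 8 < dc m -> abelian_grp G) /\
      (forall eps : R, 0 < eps -> 1 / 2 + eps <= dc m ->
         exists n : nat, n%:R <= eps^-1 /\ index_atmost (@centre G) n)) /\
  (exists C : R, 0 < C /\
    forall (G : groupType) (m : (G -> R) -> R),
      is_mean m -> left_invariant m ->
      forall alpha : R, 0 < alpha -> alpha <= dc m ->
      exists Gam H : G -> Prop,
        [/\ is_normal Gam, is_normal H,
            (exists n : nat, (n%:Z <= Num.ceil alpha^-1)%R /\ index_atmost Gam n),
            card_atmost H (expR (C * alpha `^ (- C)))
          & 
            (forall h, H h -> Gam h) /\ quotient_abelian Gam H]).
Proof.
split=> [G m m_mean m_inv|].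
  by split=> [|eps]; [exact: abelian_of_dc|exact: centre_index_of_dc].
exists (2 * 7 ^+ 5); split=> [|G m m_mean m_inv a a0 a_dc]; first by lra.
have a1 : a <= 1 by apply: le_trans a_dc (dc_le1 m_mean).
have ainv0 : 0 < a^-1 by rewrite invr_gt0.
set N := `|Num.ceil a^-1|%N.
have NE : N%:Z = Num.ceil a^-1 by rewrite gez0_abs // ceil_ge0; lra.
have NR : N%:R = (Num.ceil a^-1)%:~R :> R by rewrite -NE.
have N_ge : a^-1 <= N%:R by rewrite NR ceil_ge.
have N_lt : N%:R < a^-1 + 1 by have := gt_pred_ceil a^-1; rewrite NR intrD; lra.
pose r := (N * N.+1).+1.
pose X (x : G) := r%:R^-1 <= mu m (commute x).
have Nr : (N < r)%N by rewrite /r; nia.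
have N0 : 0 < N%:R :> R by lra.
(* As [r] exceeds [N * (N + 1)], [N^-1 - r^-1 > (N + 1)^-1]. Strictness matters: it forces the index
   of [gen X] below [N + 1]. *)
have X_large : N.+1%:R^-1 < mu m X.
  have dcX : dc m <= mu m X + r%:R^-1.
    by apply: (dc_le_threshold m_mean); rewrite invr_ge0.
  have aN : N%:R^-1 <= a by rewrite -[a]invrK lef_pV2 ?posrE.
  have : r%:R^-1 < N%:R^-1 - N.+1%:R^-1 :> R.
    have -> : N%:R^-1 - N.+1%:R^-1 = (N * N.+1)%:R^-1 :> R.
      by rewrite natrM -natr1; field; apply/andP; split; rewrite gt_eqF //; lra.
    by rewrite ltf_pV2 ?posrE ?ltr_nat // natrM mulr_gt0 // ltr0n.
  rewrite ltrBrDr => /lt_le_trans/(_ (le_trans aN (le_trans a_dc dcX))).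
  by rewrite addrC ltrD2r.
have K_group : is_subgroup (gen X) by exact/gen_subgroup/threshold_setV.
have KJ g x : gen X x -> gen X (x ^ g)%g.
  by apply: genJ => y; exact: threshold_setJ.
have [L [L_group LK L_cov]] := commutators_covered m_mean m_inv Nr X_large.
have K_large : N.+1%:R^-1 < mu m (gen X).
  by apply: lt_le_trans X_large _; apply: mu_le => // x; exact: gen_incl.
have NS0 : 0 < N.+1%:R^-1 :> R by rewrite invr_gt0.
(* [L] is not known to be normal in [G]. The derived subgroup of [gen X] is normal, and it lies in
   [L], so it inherits the size bound. *)
exists (gen X), (derived (gen X)); split.
- by split=> // g x Kx; rewrite -mulgA -conjgE; exact: KJ.
- by apply: derived_normal.
- exists N; split; first by rewrite NE.
  apply: (index_atmost_mu m_mean m_inv K_group); first exact: lt_trans K_large.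
  by rewrite -[ltRHS]invrK ltf_pV2 ?posrE // (lt_trans NS0).
- have [l [lk lL]] := L_cov.
  have cov : covered (derived (gen X)) ((r`! ^ r) ^ (2 * (r * (3 * N).+1))).
    by exists l; split=> // g /(derived_min L_group LK)/lL.
  apply: (card_atmost_covered cov); apply: le_trans (fact_expn_le_expR _ _ _) _.
  by rewrite ler_expR; exact: exponent_bound.
- split; last by move=> x y Kx Ky; apply: gen_incl; exists x, y.
  apply: derived_min => // x y Kx Ky; have [K1 KM KV] := K_group.
  rewrite /commg conjgE; apply: (KM); first exact: KV.
  by apply: (KM); [exact: KV|exact: KM].
Qed.
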